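(* Let $\mathbb{F}$ be a field, let $$1\to N\to\Gamma\xrightarrow{\pi}G\to1\quad\text{and}\quad1\to N'\to\Gamma'\xrightarrow{\pi'}G\to1$$ be two group extensions of $G$, and let $c\in Z^2(\Gamma,\mathbb{F}^* )$ and $c'\in Z^2(\Gamma',\mathbb{F}^* )$. Then $$\mathbb{F}^{c}\Gamma\otimes^G_{\mathbb{F}}\mathbb{F}^{c'}\Gamma'\stackrel{G}{\cong}\mathbb{F}^{c\times_Gc'}(\Gamma\times_G\Gamma'),$$ where $c\times_Gc'\in Z^2(\Gamma\times_G\Gamma',\mathbb{F}^* )$ is given by $$(c\times_Gc')((\gamma_1,\gamma'_1),(\gamma_2,\gamma'_2)):=c(\gamma_1,\gamma_2)\cdot c'(\gamma'_1,\gamma'_2),\quad\forall(\gamma_1,\gamma'_1),(\gamma_2,\gamma'_2)\in\Gamma\times_G\Gamma'.$$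
   Context: $\Gamma\times_G\Gamma'=\{(\gamma,\gamma')\in\Gamma\times\Gamma':\pi(\gamma)=\pi'(\gamma')\}$ is the pull-back. Cocycles are with respect to the trivial action on $\mathbb{F}^*$. For $c\in Z^2(\Gamma,\mathbb{F}^* )$, $\mathbb{F}^c\Gamma=\bigoplus_{\gamma\in\Gamma}\mathbb{F}u_\gamma$ with $u_{\gamma_1}u_{\gamma_2}=c(\gamma_1,\gamma_2)u_{\gamma_1\gamma_2}$ is the twisted group algebra; it is $G$-graded through $\pi$, i.e. its $g$-component is the span of the $u_\gamma$ with $\pi(\gamma)=g$. Similarly $\mathbb{F}^{c'}\Gamma'$ is $G$-graded through $\pi'$, and $\mathbb{F}^{c\times_Gc'}(\Gamma\times_G\Gamma')$ through $(\gamma,\gamma')\mapsto\pi(\gamma)=\pi'(\gamma')$. The graded product of $G$-graded algebras is the $G$-graded algebra $A_G\otimes^G_{\mathbb{F}}A'_G=\bigoplus_{g\in G}A_g\otimes_{\mathbb{F}}A'_g\subseteq A_G\otimes_{\mathbb{F}}A'_G$. $\stackrel{G}{\cong}$ denotes a degree-preserving algebra isomorphism. *)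

(* Defs.v *)
From HB Require Import structures.
From mathcomp Require Import all_boot all_algebra.
From mathcomp Require Import finmap monalg.
From mathcomp Require Import boolp classical_sets.

Set Implicit Arguments.
Unset Strict Implicit.
Unset Printing Implicit Defensive.

Import GRing.Theory.
Local Open Scope ring_scope.
Local Open Scope quotient_scope.

Inductive lspan (F : fieldType) (V : lmodType F) (S : V -> Prop) : V -> Prop :=
| lspan0 : lspan S 0
| lspanZD (a : F) (x y : V) : S x -> lspan S y -> lspan S (a *: x + y).

Section SpanTheory.
Variables (F : fieldType) (V : lmodType F) (S : V -> Prop).

Lemma lspanD x y : lspan S x -> lspan S y -> lspan S (x + y).
Proof.
move=> Sx Sy; elim: Sx => [|a u v Su _ IH]; first by rewrite add0r.
by rewrite -addrA; apply: lspanZD.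
Qed.

Lemma lspanZ a x : lspan S x -> lspan S (a *: x).
Proof.
elim=> [|b u v Su _ IH]; first by rewrite scaler0; apply: lspan0.
by rewrite scalerDr scalerA; apply: lspanZD.
Qed.

Lemma lspanS x : S x -> lspan S x.
Proof. by move=> Sx; rewrite -[x]scale1r -[X in lspan S X]addr0; apply: lspanZD => //; apply: lspan0. Qed.

Lemma lspan_lin a x y : lspan S x -> lspan S y -> lspan S (a *: x + y).
Proof. by move=> Sx; apply/lspanD/lspanZ. Qed.

Lemma lspanB x y : lspan S x -> lspan S y -> lspan S (x - y).
Proof. by move=> Sx Sy; rewrite -scaleN1r; apply: lspanD => //; apply: lspanZ. Qed.

End SpanTheory.

Lemma lspan_ker (F : fieldType) (V U : lmodType F) (S : V -> Prop)
    (f : {linear V -> U}) :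
  (forall x, S x -> f x = 0) -> forall x, lspan S x -> f x = 0.
Proof.
move=> Sf x; elim=> [|a u v Su _ IH]; first by rewrite linear0.
by rewrite linearP Sf // scaler0 add0r.
Qed.

Section LinearExtension.
Variables (F : fieldType) (K : choiceType).

Lemma malg_ind (P : {malg F[K]} -> Prop) :
  P 0 -> (forall a k x, P x -> P (a *: << k >> + x)) -> forall x, P x.
Proof.
move=> P0 PD x; rewrite (monalgE x); elim: (enum_fset _) => [|k s IH].
  by rewrite big_nil.
rewrite big_cons; suff -> : << x@_k *g k >> = x@_k *: << k >> by apply: PD.
by apply/malgP => j; rewrite mcoeffZ !mcoeffU mulrnAr mulr1.
Qed.

Variables (U : lmodType F) (h : K -> U).

Definition lext (x : {malg F[K]}) : U := \sum_(k <- msupp x) x@_k *: h k.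

Lemma lextEw (d : {fset K}) x : (msupp x `<=` d)%fset ->
  lext x = \sum_(k <- d) x@_k *: h k.
Proof.
move=> le; rewrite /lext (big_fset_incl _ le) // => k _ /mcoeff_outdom ->.
by rewrite scale0r.
Qed.

Lemma lext_is_linear : linear lext.
Proof.
move=> a x y.
pose d := (msupp x `|` msupp y)%fset.
have sx : (msupp x `<=` d)%fset by apply: fsubsetUl.
have sy : (msupp y `<=` d)%fset by apply: fsubsetUr.
have sz : (msupp (a *: x + y) `<=` d)%fset.
  apply: fsubset_trans (msuppD_le _ _) _; apply: fsetSU; exact: msuppZ_le.
rewrite (lextEw sx) (lextEw sy) (lextEw sz) scaler_sumr -big_split /=.
by apply: eq_bigr => k _; rewrite mcoeffD mcoeffZ scalerDl scalerA.
Qed.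
HB.instance Definition _ :=
  GRing.isLinear.Build F {malg F[K]} U *:%R lext lext_is_linear.

Lemma lextU k : lext << k >> = h k.
Proof. by rewrite /lext msuppU oner_eq0 big_seq_fset1 mcoeffUU scale1r. Qed.

End LinearExtension.

(* V (x)_F W is the free vector space on V * W modulo the bilinearity         *)
(* relations.                                                                 *)
Section Tensor.
Variables (F : fieldType) (V W : lmodType F).
Local Notation L := {malg F[(V * W)%type]}.

Inductive bilinear_rel : L -> Prop :=
| bilinear_rel_l (a : F) (v1 v2 : V) (w : W) :
    bilinear_rel (<< (a *: v1 + v2, w) >> - a *: << (v1, w) >> - << (v2, w) >>)
| bilinear_rel_r (a : F) (v : V) (w1 w2 : W) :
    bilinear_rel (<< (v, a *: w1 + w2) >> - a *: << (v, w1) >> - << (v, w2) >>).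

Definition tensor_null : {pred L} := [pred x | `[< lspan bilinear_rel x >]].

Lemma tensor_null_zmod : zmod_closed tensor_null.
Proof.
split=> [|x y]; first exact/asboolP/lspan0.
by move=> /asboolP Sx /asboolP Sy; apply/asboolP/lspanB.
Qed.
HB.instance Definition _ := GRing.isZmodClosed.Build L tensor_null tensor_null_zmod.

Definition tensor : Type := Quotient.quot tensor_null.
HB.instance Definition _ := GRing.Zmodule.on tensor.

End Tensor.

(* Locking prevents unification from unfolding the quotient. *)
HB.lock Definition tproj (F : fieldType) (V W : lmodType F)
  (x : {malg F[(V * W)%type]}) : tensor V W := \pi_(Quotient.quot (@tensor_null F V W)) x.

HB.lock Definition trepr (F : fieldType) (V W : lmodType F)
  (x : tensor V W) : {malg F[(V * W)%type]} :=
  repr (x : Quotient.quot (@tensor_null F V W)).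

HB.lock Definition tscale (F : fieldType) (V W : lmodType F)
  (a : F) (x : tensor V W) : tensor V W := tproj (a *: trepr x).

HB.lock Definition tens (F : fieldType) (V W : lmodType F) (v : V) (w : W) :
  tensor V W := tproj << (v, w) >>.
Arguments tens {F V W}.

Section TensorTheory.
Variables (F : fieldType) (V W : lmodType F).
Local Notation L := {malg F[(V * W)%type]}.
Local Notation tensor := (tensor V W).
Local Notation bilinear_rel := (@bilinear_rel F V W).
Local Notation tproj := (@tproj F V W).
Local Notation trepr := (@trepr F V W).
Local Notation tscale := (@tscale F V W).

Lemma treprK : cancel trepr tproj.
Proof. by move=> x; rewrite tproj.unlock trepr.unlock; apply: reprK. Qed.

Lemma tproj_eq x y : tproj x = tproj y <-> lspan bilinear_rel (x - y).
Proof.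
rewrite tproj.unlock; split=> [/eqP|Sxy].
  by rewrite -Quotient.idealrBE => /asboolP.
by apply/eqP; rewrite -Quotient.idealrBE; apply/asboolP.
Qed.

Lemma tprojD x y : tproj (x + y) = tproj x + tproj y.
Proof. by rewrite tproj.unlock; apply: raddfD. Qed.

Lemma tscale_proj a x : tscale a (tproj x) = tproj (a *: x).
Proof.
rewrite tscale.unlock; apply/tproj_eq; rewrite -scalerBr; apply/lspanZ/tproj_eq; exact: treprK.
Qed.

Lemma tscaleA a b x : tscale a (tscale b x) = tscale (a * b) x.
Proof. by rewrite -[x]treprK !tscale_proj scalerA. Qed.
Lemma tscale1 : left_id 1 tscale.
Proof. by move=> x; rewrite -[x]treprK !tscale_proj scale1r. Qed.
Lemma tscaleDr : right_distributive tscale +%R.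
Proof.
move=> a x y; rewrite -[x]treprK -[y]treprK -tprojD.
by rewrite !tscale_proj scalerDr tprojD.
Qed.
Lemma tscaleDl x : {morph tscale^~ x : a b / a + b}.
Proof. by move=> a b; rewrite /= -[x]treprK !tscale_proj scalerDl tprojD. Qed.
HB.instance Definition _ :=
  GRing.Zmodule_isLmodule.Build F tensor tscaleA tscale1 tscaleDr tscaleDl.

Lemma tproj_is_linear : linear tproj.
Proof. by move=> a x y; rewrite tprojD -tscale_proj. Qed.
HB.instance Definition _ :=
  GRing.isLinear.Build F L tensor *:%R tproj tproj_is_linear.

Lemma tensPl a (v1 v2 : V) (w : W) : tens (a *: v1 + v2) w = a *: tens v1 w + tens v2 w.
Proof.
rewrite tens.unlock -linearP; apply/tproj_eq; rewrite opprD addrA.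
exact/lspanS/bilinear_rel_l.
Qed.
Lemma tensPr a (v : V) (w1 w2 : W) : tens v (a *: w1 + w2) = a *: tens v w1 + tens v w2.
Proof.
rewrite tens.unlock -linearP; apply/tproj_eq; rewrite opprD addrA.
exact/lspanS/bilinear_rel_r.
Qed.

Lemma tens0l (w : W) : tens (0 : V) w = 0.
Proof. by have := tensPl (-1) 0 0 w; rewrite scaler0 addr0 scaleN1r addNr. Qed.

Lemma tensor_ind (P : tensor -> Prop) :
  P 0 -> (forall a v w x, P x -> P (a *: tens v w + x)) -> forall x, P x.
Proof.
move=> P0 PD x; rewrite -[x]treprK; elim/malg_ind: (trepr x) => [|a [v w] y IH].
  by rewrite linear0.
by rewrite linearP; have := PD a v w; rewrite tens.unlock; apply.
Qed.

Variable U : lmodType F.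

Definition bilin (f : V -> W -> U) : Prop :=
  (forall a v1 v2 w, f (a *: v1 + v2) w = a *: f v1 w + f v2 w) /\
  (forall a v w1 w2, f v (a *: w1 + w2) = a *: f v w1 + f v w2).

Definition tlift (f : V -> W -> U) (x : tensor) : U :=
  lext (fun k : V * W => f k.1 k.2) (trepr x).

Variable f : V -> W -> U.
Hypothesis f_bilin : bilin f.

Lemma tlift_proj x : tlift f (tproj x) = lext (fun k : V * W => f k.1 k.2) x.
Proof.
have /tproj_eq S : tproj (trepr (tproj x)) = tproj x by rewrite treprK.
apply/eqP; rewrite -subr_eq0 -linearB; apply/eqP; apply: lspan_ker S.
case: f_bilin => fl fr _ [a v1 v2 w|a v w1 w2];
  rewrite !linearB linearZ /= !lextU /= ?fl ?fr addrAC addrK ?subrr //.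
Qed.

Lemma tliftP a x y : tlift f (a *: x + y) = a *: tlift f x + tlift f y.
Proof. by rewrite -[x]treprK -[y]treprK -linearP !tlift_proj linearP. Qed.

Lemma tlift0 : tlift f 0 = 0.
Proof. by have := tlift_proj 0; rewrite !linear0. Qed.

Lemma tlift_tens v w : tlift f (tens v w) = f v w.
Proof. by rewrite tens.unlock tlift_proj lextU. Qed.

End TensorTheory.

Lemma eq_tlift (F : fieldType) (V W U : lmodType F) (f g : V -> W -> U) x :
  (forall v w, f v w = g v w) -> tlift f x = tlift g x.
Proof. by move=> fg; apply: eq_bigr => k _; rewrite fg. Qed.

(* Needed for 1 (x) 1 <> 0, as algType requires a nonzero ring.               *)
Section Functional.
Variables (F : fieldType) (V : lmodType F) (v : V).
Hypothesis v_neq0 : v <> 0.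

Let good (W : set V) :=
  [/\ W 0, (forall a x y, W x -> W y -> W (a *: x + y)) & ~ W v].

Lemma exists_functional :
  exists f : V -> F, (forall a x y, f (a *: x + y) = a * f x + f y) /\ f v = 1.
Proof.
pose T := {W : set V | good W}.
pose R (A B : T) : bool := `[< subset (sval A) (sval B) >].
have good0 : good (fun x => x = 0).
  split=> // a x y -> ->; by rewrite scaler0 addr0.
have [||||Mt Mmax] := @Zorn T R.
- by move=> t; apply/asboolP.
- by move=> r s t /asboolP rs /asboolP st; apply/asboolP => x /rs /st.
- move=> [s Hs] [t Ht] /asboolP /= st /asboolP /= ts.
  by apply: eq_exist; apply/seteqP.
- move=> A Atot; have [[a Aa]|nA] := pselect (exists a, A a); last first.
    exists (exist _ _ good0) => s As; case: nA; by exists s.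
  pose B : set V := fun x => exists2 a : T, A a & sval a x.
  have gB : good B.
    split.
    - exists a => //; by case: (svalP a).
    - move=> k x y [r Ar rx] [s As sy].
      have [/asboolP rs|/asboolP sr] := Atot r s Ar As.
        exists s => //; case: (svalP s) => _ slin _; apply: slin => //; exact: rs.
      exists r => //; case: (svalP r) => _ rlin _; apply: rlin => //; exact: sr.
    - by move=> [r Ar rv]; case: (svalP r).
  by exists (exist _ B gB) => s As; apply/asboolP => x sx; exists s.
have {R Mmax Mt} [M [M0 Mlin Mv] Mmax] :
    exists2 M, good M & forall M', good M' -> subset M M' -> M' = M.
  case: Mt Mmax => M gM Mmax; exists M => // M' gM' sM.
  have rM : R (exist _ M gM) (exist _ M' gM') by apply/asboolP.
  by have /(congr1 (fun t : T => sval t)) := Mmax _ rM.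
have dec x : exists k, M (x - k *: v).
  have [Mx|nMx] := pselect (M x); first by exists 0; rewrite scale0r subr0.
  pose Mx : set V := fun y => exists2 m, M m & exists k, y = k *: x + m.
  have subMx : subset M Mx by move=> m Mm; exists m => //; exists 0; rewrite scale0r add0r.
  have [gMx|ngMx] := pselect (good Mx).
    case: nMx; rewrite -(Mmax _ gMx subMx).
    by exists 0 => //; exists 1; rewrite scale1r addr0.
  have [m Mm [k vE]] : Mx v.
    have [//|nv] := pselect (Mx v); case: ngMx; split=> //.
    - exact: subMx.
    - move=> a _ _ [m Mm [k ->]] [n Mn [l ->]].
      exists (a *: m + n); first exact: Mlin.
      by exists (a * k + l); rewrite scalerDr scalerA scalerDl addrACA.
  have k0 : k != 0.
    by apply/eqP => k0; apply: Mv; rewrite vE k0 scale0r add0r.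
  exists k^-1; rewrite vE scalerDr scalerA mulVf // scale1r opprD addrA subrr add0r.
  rewrite -scalerN -scaleN1r scalerA -[X in M X]addr0; exact: Mlin.
have uniqk x k l : M (x - k *: v) -> M (x - l *: v) -> k = l.
  move=> Mk Ml; apply/eqP; rewrite -subr_eq0; apply/eqP; apply: contrapT => /eqP kl.
  have vE : (k - l)^-1 *: (- 1 *: (x - k *: v) + (x - l *: v)) + 0 = v.
    rewrite scaleN1r opprB addrA subrK -scalerBl scalerA mulVf // scale1r.
    by rewrite addr0.
  by apply: Mv; rewrite -vE; apply: (Mlin _ _ _ _ M0); apply: Mlin.
exists (fun x => sval (cid (dec x))); split=> [a x y|].
  case: cid => z Mz; case: cid => k Mk; case: cid => l Ml /=.
  apply: uniqk Mz _; rewrite scalerDl -scalerA opprD addrACA -scalerBr.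
  exact: Mlin.
by case: cid => k Mk /=; apply: uniqk Mk _; rewrite scale1r subrr.
Qed.

End Functional.

Section TensorAlgebra.
Variables (F : fieldType) (A B : algType F).
Local Notation T := (tensor A B).

Definition tmul (x y : T) : T :=
  tlift (fun a b => tlift (fun a' b' => tens (a * a') (b * b')) y) x.

Lemma tmul_bilin a b : bilin (fun a' b' => tens (a * a') (b * b') : T).
Proof.
by split=> *; rewrite mulrDr -scalerAr ?tensPl ?tensPr.
Qed.

Let pmul (a : A) (b : B) (y : T) : T := tlift (fun a' b' => tens (a * a') (b * b')) y.

Let pmul0 a b : pmul a b 0 = 0.
Proof. exact/tlift0/tmul_bilin. Qed.
Let pmulP a b k x y : pmul a b (k *: x + y) = k *: pmul a b x + pmul a b y.
Proof. exact/tliftP/tmul_bilin. Qed.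
Let pmul_tens a b a' b' : pmul a b (tens a' b') = tens (a * a') (b * b').
Proof. by rewrite /pmul tlift_tens //; apply: tmul_bilin. Qed.

Lemma tmul_bilin2 y : bilin (fun a b => pmul a b y).
Proof.
split=> k u v w; elim/tensor_ind: y => [|l p q z IH].
- by rewrite !pmul0 scaler0 addr0.
- rewrite !pmulP IH !pmul_tens mulrDl -scalerAl tensPl !scalerDr.
  by rewrite addrACA !scalerA [k * l]mulrC.
- by rewrite !pmul0 scaler0 addr0.
- rewrite !pmulP IH !pmul_tens mulrDl -scalerAl tensPr !scalerDr.
  by rewrite addrACA !scalerA [k * l]mulrC.
Qed.

Lemma tmul_tensl a b y : tmul (tens a b) y = pmul a b y.
Proof. by rewrite /tmul tlift_tens //; apply: tmul_bilin2. Qed.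

Lemma tmul_tens a b a' b' : tmul (tens a b) (tens a' b') = tens (a * a') (b * b').
Proof. by rewrite tmul_tensl pmul_tens. Qed.

Lemma tmulPl a x y z : tmul (a *: x + y) z = a *: tmul x z + tmul y z.
Proof. exact/tliftP/tmul_bilin2. Qed.

Lemma tmul0l z : tmul 0 z = 0.
Proof. exact/tlift0/tmul_bilin2. Qed.

Lemma tmulPr a x y z : tmul z (a *: x + y) = a *: tmul z x + tmul z y.
Proof.
elim/tensor_ind: z => [|k u v w IH]; first by rewrite !tmul0l scaler0 addr0.
rewrite !tmulPl IH !tmul_tensl pmulP.
by rewrite !scalerDr addrACA !scalerA [k * a]mulrC.
Qed.

Lemma tmul0r z : tmul z 0 = 0.
Proof.
elim/tensor_ind: z => [|k u v w IH]; first exact: tmul0l.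
by rewrite tmulPl IH tmul_tensl pmul0 scaler0 addr0.
Qed.

Lemma tmulA : associative tmul.
Proof.
move=> x y z; elim/tensor_ind: x => [|k a a' x IH]; first by rewrite !tmul0l.
rewrite !tmulPl IH; congr (_ *: _ + _).
elim/tensor_ind: y {IH} => [|l b b' y IH]; first by rewrite !(tmul0l, tmul0r).
rewrite tmulPl !tmulPr tmulPl IH; congr (_ *: _ + _).
elim/tensor_ind: z {IH} => [|m c c' z IH]; first by rewrite !tmul0r.
by rewrite !tmulPr IH !tmul_tens !mulrA.
Qed.

Lemma tmul1l : left_id (tens 1 1) tmul.
Proof.
elim/tensor_ind => [|k a a' x IH]; first by rewrite tmul0r.
by rewrite tmulPr IH tmul_tens !mul1r.
Qed.

Lemma tmul1r : right_id (tens 1 1) tmul.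
Proof.
elim/tensor_ind => [|k a a' x IH]; first by rewrite tmul0l.
by rewrite tmulPl IH tmul_tens !mulr1.
Qed.

Lemma tmulDl : left_distributive tmul +%R.
Proof. by move=> x y z; rewrite -[x]scale1r tmulPl !scale1r. Qed.
Lemma tmulDr : right_distributive tmul +%R.
Proof. by move=> z x y; rewrite -[x]scale1r tmulPr !scale1r. Qed.

Lemma tens11_neq0 : tens 1 1 != 0 :> T.
Proof.
have [f [fl f1]] := @exists_functional F A 1 (elimN eqP (oner_neq0 _)).
have [g [gl g1]] := @exists_functional F B 1 (elimN eqP (oner_neq0 _)).
have fg : @bilin F A B F^o (fun a b => f a * g b).
  split=> [a u v w|a w u v]; first by rewrite fl mulrDl -mulrA.
  by rewrite gl mulrDr mulrCA.
apply/eqP => /(congr1 (@tlift F A B F^o (fun a b => f a * g b))).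
rewrite tlift_tens // tlift0 // f1 g1 mulr1 => /eqP.
by rewrite oner_eq0.
Qed.

HB.instance Definition _ := GRing.Zmodule_isNzRing.Build T
  tmulA tmul1l tmul1r tmulDl tmulDr tens11_neq0.

Lemma tensM (a a' : A) (b b' : B) :
  (tens a b * tens a' b' : T) = tens (a * a') (b * b').
Proof. exact: tmul_tens. Qed.

Lemma tscaleAl a (x y : T) : a *: (x * y) = a *: x * y.
Proof. by have := tmulPl a x 0 y; rewrite tmul0l !addr0. Qed.
HB.instance Definition _ := GRing.Lmodule_isLalgebra.Build F T tscaleAl.
Lemma tscaleAr a (x y : T) : a *: (x * y) = x * (a *: y).
Proof. by have := tmulPr a y 0 x; rewrite tmul0r !addr0. Qed.
HB.instance Definition _ := GRing.Lalgebra_isAlgebra.Build F T tscaleAr.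

End TensorAlgebra.

(* A is the internal direct sum of the subspaces A_g = gcomp g: a finitely    *)
(* supported family (d_g) of elements of A is encoded as d : {malg A[G]}.     *)
Definition dsum (G : choiceType) (V : zmodType) (d : {malg V[G]}) : V :=
  \sum_(g <- msupp d) d@_g.

Record grading (G : groupType) (F : fieldType) (A : algType F) := Grading {
  gcomp : G -> A -> Prop;
  gcomp0 : forall g, gcomp g 0;
  gcomp_lin : forall g (a : F) x y,
    gcomp g x -> gcomp g y -> gcomp g (a *: x + y);
  gcompM : forall g h x y, gcomp g x -> gcomp h y -> gcomp (g * h)%g (x * y);
  gcomp_direct : forall x,
    exists! d : {malg A[G]}, (forall g, gcomp g d@_g) /\ x = dsum d
}.

Record gradedAlg (G : groupType) (F : fieldType) := GradedAlg {
  galg :> algType F;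
  galg_grading : grading G galg
}.

Definition homog (G : groupType) (F : fieldType) (A : gradedAlg G F) :
  G -> A -> Prop := gcomp (galg_grading A).

Definition graded_iso (G : groupType) (F : fieldType) (A B : gradedAlg G F) : Prop :=
  exists f : {lrmorphism A -> B},
    bijective f /\ forall g (x : A), homog g x <-> homog g (f x).

Lemma dsumEw (G : choiceType) (V : zmodType) (s : {fset G}) (d : {malg V[G]}) :
  (msupp d `<=` s)%fset -> dsum d = \sum_(g <- s) d@_g.
Proof.
by move=> le; rewrite /dsum (big_fset_incl _ le) // => k _ /mcoeff_outdom.
Qed.

Lemma dsum_is_zmod_morphism (G : choiceType) (V : zmodType) :
  zmod_morphism (@dsum G V).
Proof.
move=> x y; pose s := (msupp x `|` msupp y)%fset.
rewrite (@dsumEw _ _ s x) ?fsubsetUl // (@dsumEw _ _ s y) ?fsubsetUr //.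
rewrite (@dsumEw _ _ s (x - y)) ?msuppB_le // -sumrB.
by apply: eq_bigr => g _; rewrite mcoeffB.
Qed.
HB.instance Definition _ (G : choiceType) (V : zmodType) :=
  GRing.isZmodMorphism.Build {malg V[G]} V (@dsum G V)
    (@dsum_is_zmod_morphism G V).

Lemma dsumU (G : choiceType) (V : zmodType) (g : G) (x : V) :
  dsum << x *g g >> = x.
Proof. by rewrite (dsumEw msuppU_le) big_seq_fset1 mcoeffUU. Qed.

Section GradingTheory.
Variables (G : groupType) (F : fieldType) (A : gradedAlg G F).

Lemma homog0 g : @homog G F A g 0. Proof. exact: gcomp0. Qed.

Lemma homog_lin g a (x y : A) : homog g x -> homog g y -> homog g (a *: x + y).
Proof. exact: gcomp_lin. Qed.

Lemma homogM g h (x y : A) : homog g x -> homog h y -> homog (g * h)%g (x * y).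
Proof. exact: gcompM. Qed.

Definition gdec (x : A) : {malg A[G]} :=
  sval (cid (gcomp_direct (galg_grading A) x)).

Lemma gdec_homog x g : homog g (gdec x)@_g.
Proof. by rewrite /gdec; case: cid => d [[dh ?] ?]; apply: dh. Qed.

Lemma gdec_sum x : dsum (gdec x) = x.
Proof. by rewrite /gdec; case: cid => d [[? dE] ?]. Qed.

Lemma gdec_uniq d x : (forall g, homog g d@_g) -> x = dsum d -> gdec x = d.
Proof. by move=> dh xE; rewrite /gdec; case: cid => e [? eU]; apply: eU. Qed.

Lemma gdecU x g : homog g x -> gdec x = << x *g g >>.
Proof.
move=> xg; apply: gdec_uniq; last by rewrite dsumU.
move=> h; rewrite mcoeffU; case: eqP => [<-|_] //=; exact: homog0.
Qed.

Definition gproj (g : G) (x : A) : A := (gdec x)@_g.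

Lemma gprojP g a x y : gproj g (a *: x + y) = a *: gproj g x + gproj g y.
Proof.
suff -> : gproj g (a *: x + y) = (a%:A *: gdec x + gdec y)@_g.
  by rewrite mcoeffD mcoeffZ mulr_algl.
congr mcoeff; apply: gdec_uniq => [h|].
  by rewrite mcoeffD mcoeffZ mulr_algl; apply: homog_lin; apply: gdec_homog.
rewrite raddfD /= gdec_sum; congr (_ + _).
have le : (msupp (a%:A *: gdec x) `<=` msupp (gdec x))%fset by apply: msuppZ_le.
rewrite (dsumEw le) -{1}[x]gdec_sum /dsum scaler_sumr.
by apply: eq_bigr => h _; rewrite mcoeffZ mulr_algl.
Qed.

Lemma gproj_id g x : homog g x -> gproj g x = x.
Proof. by move=> /gdecU xE; rewrite /gproj xE mcoeffUU. Qed.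

Lemma gproj_neq g h x : homog g x -> g != h -> gproj h x = 0.
Proof. by move=> /gdecU xE gh; rewrite /gproj xE mcoeffU (negbTE gh). Qed.

Lemma homog1 : @homog G F A 1%g 1.
Proof.
pose e := gproj 1%g (1 : A).
have xe h x : homog h x -> x = x * e.
  move=> xh; pose d : {malg A[G]} :=
    \sum_(g <- msupp (gdec 1)) << x * (gdec 1)@_g *g (h * g)%g >>.
  have dE k : d@_k = x * (gdec 1)@_(h^-1 * k)%g.
    rewrite raddf_sum /=.
    have [kin|kout] := boolP ((h^-1 * k)%g \in msupp (gdec 1)).
      rewrite (big_fsetD1 _ kin) /= mcoeffU mulVKg eqxx mulr1n.
      rewrite big1_fset ?addr0 // => g; rewrite !inE => /andP[gk _] _.
      by rewrite mcoeffU; case: eqP => // hgk; rewrite -hgk mulKg eqxx in gk.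
    rewrite (mcoeff_outdom kout) mulr0 big1_fset // => g gin _.
    rewrite mcoeffU; case: eqP => // hgk.
    by rewrite -hgk mulKg gin in kout.
  have xd : gdec x = d.
    apply: gdec_uniq => [k|].
      rewrite dE -[X in homog X _](mulVKg h); apply: homogM => //.
      exact: gdec_homog.
    rewrite -[LHS]mulr1 -{1}[1]gdec_sum /dsum mulr_sumr -/(dsum d) /d raddf_sum /=.
    by apply: eq_bigr => g _; rewrite dsumU.
  by rewrite -{1}(gproj_id xh) /gproj xd dE mulVg.
suff -> : 1 = e by apply: gdec_homog.
rewrite -[RHS]mul1r -{1}[1]gdec_sum -{2}[1]gdec_sum /dsum mulr_suml.
by apply: eq_bigr => g _; apply: xe (gdec_homog _ _).
Qed.

End GradingTheory.

Section GradedProduct.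
Variables (G : groupType) (F : fieldType) (A A' : gradedAlg G F).
Local Notation T := (tensor A A').

Definition graded_prod_comp (g : G) : T -> Prop :=
  lspan (fun t => exists2 a : A, homog g a & exists2 a' : A', homog g a' & t = tens a a').

Definition graded_prod_mem : {pred T} := [pred t |
  `[< exists d : {malg T[G]}, (forall g, graded_prod_comp g d@_g) /\ t = dsum d >]].

Lemma graded_prod_compM g h x y :
  graded_prod_comp g x -> graded_prod_comp h y -> graded_prod_comp (g * h)%g (x * y).
Proof.
move=> xg yh; elim: xg => [|k _ u [a ag [a' a'g ->]] _ IH].
  by rewrite mul0r; apply: lspan0.
rewrite mulrDl; apply: lspanD => //; rewrite -scalerAl; apply: lspanZ => {IH}.
elim: yh => [|l _ v [b bh [b' b'h ->]] _ IH].
  by rewrite mulr0; apply: lspan0.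
rewrite mulrDr; apply: lspanD => //; rewrite -scalerAr tensM; apply/lspanZ/lspanS.
by exists (a * b); [exact: homogM|exists (a' * b') => //; exact: homogM].
Qed.

Let P (g : G) (x : T) : T := tlift (fun a a' => tens (gproj g a) (gproj g a')) x.

Let P_bilin g : bilin (fun a a' => tens (gproj g a) (gproj g a') : T).
Proof. by split=> *; rewrite gprojP ?tensPl ?tensPr. Qed.

Let PP g k x y : P g (k *: x + y) = k *: P g x + P g y.
Proof. exact/tliftP/P_bilin. Qed.
Let P0 g : P g 0 = 0.
Proof. exact/tlift0/P_bilin. Qed.

Let P_id g h x : graded_prod_comp g x -> P h x = x *+ (g == h).
Proof.
elim=> [|k _ u [a ag [a' a'g ->]] _ IH]; first by rewrite P0 mul0rn.
rewrite PP IH mulrnDl scalerMnr; congr (_ *: _ + _).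
rewrite /P tlift_tens; last exact: P_bilin.
have [<-|gh] := eqVneq g h; first by rewrite !gproj_id.
rewrite (gproj_neq ag gh) mulr0n.
exact: tens0l.
Qed.

Lemma graded_prod_direct (d : {malg T[G]}) :
  (forall g, graded_prod_comp g d@_g) -> forall g, d@_g = P g (dsum d).
Proof.
move=> dh g.
have PD x y : P g (x + y) = P g x + P g y by have := PP g 1 x y; rewrite !scale1r.
rewrite /dsum (big_morph _ PD (P0 g)).
under eq_bigr => h _ do rewrite (P_id g (dh h)).
have [gd|gd] := boolP (g \in msupp d); last first.
  by rewrite (mcoeff_outdom gd) big1_fset // => h hin _; case: eqP => // hg; rewrite -hg hin in gd.
rewrite (big_fsetD1 _ gd) /= eqxx mulr1n big1_fset ?addr0 // => h.
by rewrite !inE => /andP[/negbTE -> _].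
Qed.

Lemma graded_prod_comp_mem g x : graded_prod_comp g x -> x \in graded_prod_mem.
Proof.
move=> xg; apply/asboolP; exists << x *g g >>; split; last by rewrite dsumU.
move=> h; rewrite mcoeffU; case: eqP => [<-|_] //=; exact: lspan0.
Qed.

Lemma graded_prod_subalg : subalg_closed graded_prod_mem.
Proof.
have m_lin a x y : x \in graded_prod_mem -> y \in graded_prod_mem -> a *: x + y \in graded_prod_mem.
  move=> /asboolP[d [dh ->]] /asboolP[e [eh ->]].
  apply/asboolP; exists (a%:A *: d + e); split=> [g|].
    by rewrite mcoeffD mcoeffZ mulr_algl; apply: lspan_lin; [apply: dh|apply: eh].
  rewrite raddfD /=; congr (_ + _).
  have le : (msupp (a%:A *: d) `<=` msupp d)%fset by apply: msuppZ_le.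
  rewrite (dsumEw le) /dsum scaler_sumr.
  by apply: eq_bigr => h _; rewrite mcoeffZ mulr_algl.
have m0 : 0 \in graded_prod_mem by apply: (@graded_prod_comp_mem 1%g); apply: lspan0.
have mD x y : x \in graded_prod_mem -> y \in graded_prod_mem -> x + y \in graded_prod_mem.
  by move=> xm ym; rewrite -[x]scale1r; apply: m_lin.
split=> //.
  apply: (@graded_prod_comp_mem 1%g); apply: lspanS.
  by exists 1; [exact: homog1|exists 1 => //; exact: homog1].
move=> _ _ /asboolP[d [dh ->]] /asboolP[e [eh ->]].
rewrite /dsum mulr_suml; apply: (big_ind (fun x => x \in graded_prod_mem)) => // g _.
rewrite mulr_sumr; apply: (big_ind (fun x => x \in graded_prod_mem)) => // h _.
exact: graded_prod_comp_mem (graded_prod_compM (dh g) (eh h)).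
Qed.

HB.instance Definition _ := GRing.isSubalgClosed.Build F T graded_prod_mem graded_prod_subalg.

(* \bigoplus_g A_g (x) A'_g as a subalgebra of A (x) A', where A_g (x) A'_g is *)
(* identified with its image in A (x) A'.                                     *)
Definition graded_prod_sort : Type := {t : T | t \in graded_prod_mem}.
HB.instance Definition _ := SubChoice.on graded_prod_sort.
HB.instance Definition _ := [SubChoice_isSubAlgebra of graded_prod_sort by <:].

Definition graded_prod_homog (g : G) (x : graded_prod_sort) : Prop := graded_prod_comp g (val x).

Lemma graded_prod_homog0 g : graded_prod_homog g 0.
Proof. by rewrite /graded_prod_homog raddf0; apply: lspan0. Qed.

Lemma graded_prod_homog_lin g (a : F) x y :
  graded_prod_homog g x -> graded_prod_homog g y -> graded_prod_homog g (a *: x + y).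
Proof. by move=> xg yg; rewrite /graded_prod_homog linearP; apply: lspan_lin. Qed.

Lemma graded_prod_homogM g h x y :
  graded_prod_homog g x -> graded_prod_homog h y -> graded_prod_homog (g * h)%g (x * y).
Proof. by move=> xg yg; rewrite /graded_prod_homog rmorphM; apply: graded_prod_compM. Qed.

Lemma graded_prod_homog_direct x : exists! d : {malg graded_prod_sort[G]},
  (forall g, graded_prod_homog g d@_g) /\ x = dsum d.
Proof.
have /asboolP[d [dh xE]] := valP x.
pose s g : graded_prod_sort := exist _ d@_g (graded_prod_comp_mem (dh g)).
pose e : {malg graded_prod_sort[G]} := \sum_(g <- msupp d) << s g *g g >>.
have eE k : e@_k = s k.
  rewrite raddf_sum /=; case: (boolP (k \in msupp d)) => [kin|kout].
    rewrite (big_fsetD1 _ kin) /= mcoeffUU big1_fset ?addr0 // => g.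
    by rewrite !inE mcoeffU => /andP[/negbTE -> _].
  rewrite big1_fset; last first.
    by move=> g gin _; rewrite mcoeffU; case: eqP => // gk; rewrite -gk gin in kout.
  by apply/val_inj; rewrite raddf0 /= (mcoeff_outdom kout).
exists e; split=> [|f [fh xf]].
  split=> [g|]; first by rewrite eE; apply: dh.
  have -> : dsum e = \sum_(g <- msupp d) s g.
    by rewrite /e raddf_sum; apply: eq_bigr => g _; exact: dsumU.
  by apply: val_inj; rewrite xE raddf_sum.
pose f' : {malg T[G]} := \sum_(g <- msupp f) << val f@_g *g g >>.
have fE k : f'@_k = val f@_k.
  rewrite raddf_sum /=; case: (boolP (k \in msupp f)) => [kin|kout].
    rewrite (big_fsetD1 _ kin) /= mcoeffUU big1_fset ?addr0 // => g.
    by rewrite !inE mcoeffU => /andP[/negbTE -> _].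
  rewrite big1_fset; last first.
    by move=> g gin _; rewrite mcoeffU; case: eqP => // gk; rewrite -gk gin in kout.
  by rewrite (mcoeff_outdom kout).
have f'sum : dsum f' = val x.
  rewrite xf /f' raddf_sum [in RHS]/dsum [RHS]raddf_sum.
  by apply: eq_bigr => g _; exact: dsumU.
apply/malgP => g; rewrite eE; apply/val_inj; rewrite /= (graded_prod_direct dh) -xE.
rewrite -f'sum -fE; apply/esym/graded_prod_direct => h; rewrite fE; exact: fh.
Qed.

Definition graded_prod : gradedAlg G F := GradedAlg
  (Grading graded_prod_homog0 graded_prod_homog_lin graded_prod_homogM graded_prod_homog_direct).

End GradedProduct.

(* F^* is a trivial Gamma-module; its elements are the c != 0 in F.           *)
Record cocycle2 (Gamma : groupType) (F : fieldType) := Cocycle2 {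
  cocycle_fun :> Gamma -> Gamma -> F;
  cocycle_neq0 : forall x y, cocycle_fun x y != 0;
  cocycleP : forall x y z,
    cocycle_fun x y * cocycle_fun (x * y)%g z =
    cocycle_fun y z * cocycle_fun x (y * z)%g
}.

Definition tw_alg (F : fieldType) (Gamma : groupType) (c : cocycle2 Gamma F) : Type :=
  {malg F[Gamma]}.

HB.instance Definition _ (F : fieldType) (Gamma : groupType) (c : cocycle2 Gamma F) :=
  GRing.Lmodule.copy (tw_alg c) {malg F[Gamma]}.

HB.lock Definition tw_u (F : fieldType) (Gamma : groupType) (c : cocycle2 Gamma F)
    (a : Gamma) : tw_alg c := << a >>.

HB.lock Definition tw_mul (F : fieldType) (Gamma : groupType) (c : cocycle2 Gamma F)
    (x y : tw_alg c) : tw_alg c :=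
  \sum_(a <- msupp x) \sum_(b <- msupp y)
    << x@_a * y@_b * c a b *g (a * b)%g >>.

Section TwistedGroupAlgebra.
Variables (F : fieldType) (Gamma : groupType) (c : cocycle2 Gamma F).
Local Notation twisted := (tw_alg c).
Local Notation tw_mul := (@tw_mul F Gamma c).
Local Notation tw_u := (@tw_u F Gamma c).

(* The cocycle is not assumed to be normalized.                               *)
Definition tw_one : twisted := << (c 1%g 1%g)^-1 *g 1%g >>.

Let umul a b : twisted := << c a b *g (a * b)%g >>.

Lemma malgZU (k l : F) (a : Gamma) : k *: << l *g a >> = << k * l *g a >>.
Proof. by apply/malgP => b; rewrite mcoeffZ !mcoeffU mulrnAr. Qed.

Lemma tw_mulE x y : tw_mul x y = lext (fun a => lext (umul a) y) x.
Proof.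
rewrite tw_mul.unlock; apply: eq_bigr => a _; rewrite /lext scaler_sumr; apply: eq_bigr => b _.
by rewrite !malgZU mulrA.
Qed.

Lemma tw_mulPl a x y z : tw_mul (a *: x + y) z = a *: tw_mul x z + tw_mul y z.
Proof. by rewrite !tw_mulE linearP. Qed.

Lemma tw_mulPr a x y z : tw_mul z (a *: x + y) = a *: tw_mul z x + tw_mul z y.
Proof.
rewrite !tw_mulE /lext scaler_sumr -big_split /=; apply: eq_bigr => b _.
by rewrite -!/(lext _ _) linearP scalerDr !scalerA mulrC.
Qed.

Lemma tw_mul0l z : tw_mul 0 z = 0.
Proof. by rewrite tw_mulE linear0. Qed.

Lemma tw_mul0r z : tw_mul z 0 = 0.
Proof. by rewrite tw_mulE /lext big1 // => a _; rewrite -/(lext _ _) linear0 scaler0. Qed.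

Lemma tw_muluu a b : tw_mul (tw_u a) (tw_u b) = c a b *: tw_u (a * b)%g.
Proof. by rewrite tw_mulE tw_u.unlock !lextU malgZU mulr1. Qed.

Lemma tw_ind (P : twisted -> Prop) :
  P 0 -> (forall k a x, P x -> P (k *: tw_u a + x)) -> forall x, P x.
Proof. by rewrite tw_u.unlock; apply: malg_ind. Qed.

Lemma tw_congr k (u v w : twisted) : u = v -> k *: u + w = k *: v + w.
Proof. by move=> ->. Qed.

Lemma tw_mulA : associative tw_mul.
Proof.
move=> x y z; elim/tw_ind: x => [|k a x IH]; first by rewrite !tw_mul0l.
rewrite !tw_mulPl IH; apply: tw_congr.
elim/tw_ind: y {IH} => [|l b y IH]; first by rewrite !(tw_mul0l, tw_mul0r).
rewrite tw_mulPl !tw_mulPr tw_mulPl IH; apply: tw_congr.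
elim/tw_ind: z {IH} => [|m d z IH]; first by rewrite !tw_mul0r.
rewrite !tw_mulPr IH; apply: tw_congr.
rewrite !tw_muluu -[_ *: tw_u _ in LHS]addr0 -[_ *: tw_u _ in RHS]addr0.
rewrite tw_mulPl tw_mulPr tw_mul0l tw_mul0r !addr0 !tw_muluu !scalerA.
by rewrite -cocycleP mulgA.
Qed.

Lemma cocycle1l a : c 1%g a = c 1%g 1%g.
Proof.
have := cocycleP c 1%g 1%g a; rewrite !mul1g.
by move=> /(mulIf (cocycle_neq0 c 1%g a)).
Qed.

Lemma cocycle1r a : c a 1%g = c 1%g 1%g.
Proof.
have := cocycleP c a 1%g 1%g; rewrite !mulg1.
by move=> /(mulIf (cocycle_neq0 c a 1%g)).
Qed.

Lemma tw_oneE : tw_one = (c 1%g 1%g)^-1 *: tw_u 1%g + 0.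
Proof. by rewrite addr0 tw_u.unlock malgZU mulr1. Qed.

Lemma tw_mul1l : left_id tw_one tw_mul.
Proof.
move=> x; elim/tw_ind: x => [|k a x IH]; first by rewrite tw_mul0r.
rewrite tw_mulPr IH tw_oneE tw_mulPl tw_mul0l addr0 tw_muluu cocycle1l mul1g.
by rewrite (scalerA (c 1%g 1%g)^-1) mulVf ?cocycle_neq0 // scale1r.
Qed.

Lemma tw_mul1r : right_id tw_one tw_mul.
Proof.
move=> x; elim/tw_ind: x => [|k a x IH]; first by rewrite tw_mul0l.
rewrite tw_mulPl IH tw_oneE tw_mulPr tw_mul0r addr0 tw_muluu cocycle1r mulg1.
by rewrite (scalerA (c 1%g 1%g)^-1) mulVf ?cocycle_neq0 // scale1r.
Qed.

Lemma tw_mulDl : left_distributive tw_mul +%R.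
Proof. by move=> x y z; rewrite -[x]scale1r tw_mulPl !scale1r. Qed.

Lemma tw_mulDr : right_distributive tw_mul +%R.
Proof. by move=> z x y; rewrite -[x]scale1r tw_mulPr !scale1r. Qed.

Lemma tw_one_neq0 : tw_one != 0.
Proof. by rewrite monalgU_eq0 invr_eq0 cocycle_neq0. Qed.

HB.instance Definition _ := GRing.Zmodule_isNzRing.Build twisted
  tw_mulA tw_mul1l tw_mul1r tw_mulDl tw_mulDr tw_one_neq0.

Lemma tw_scaleAl (a : F) (x y : twisted) : a *: (x * y) = a *: x * y.
Proof. by have := tw_mulPl a x 0 y; rewrite tw_mul0l !addr0. Qed.
HB.instance Definition _ := GRing.Lmodule_isLalgebra.Build F twisted tw_scaleAl.
Lemma tw_scaleAr (a : F) (x y : twisted) : a *: (x * y) = x * (a *: y).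
Proof. by have := tw_mulPr a y 0 x; rewrite tw_mul0r !addr0. Qed.
HB.instance Definition _ := GRing.Lalgebra_isAlgebra.Build F twisted tw_scaleAr.

End TwistedGroupAlgebra.

Section TwistedGrading.
Variables (F : fieldType) (Gamma G : groupType).
Variables (pi : UMagmaMorphism.type Gamma G) (c : cocycle2 Gamma F).
Local Notation T := (tw_alg c).

Definition tw_homog (g : G) : T -> Prop :=
  lspan (fun x => exists2 a, pi a = g & x = tw_u c a).

Lemma tw_homogP g (x : T) :
  tw_homog g x <-> forall a, pi a != g -> x@_a = 0.
Proof.
split=> [xg a pag|xg].
  elim: xg => [|k _ y [b pb ->] _ IH]; first exact: mcoeff0.
  rewrite mcoeffD IH addr0 tw_u.unlock mcoeffZ mcoeffU; case: eqP => [ba|_].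
    by rewrite -ba pb eqxx in pag.
  by rewrite mulr0.
suff: forall s : seq Gamma, {subset s <= msupp x} ->
    tw_homog g (\sum_(a <- s) << x@_a *g a >> : T).
  by move=> /(_ (msupp x) (fun _ => id)); rewrite -(monalgE x).
elim=> [|a s IH] sx; first by rewrite big_nil; apply: lspan0.
rewrite big_cons -[x@_a]mulr1 -malgZU; apply: lspanZD; last first.
  by apply: IH => b bs; apply: sx; rewrite inE bs orbT.
exists a; last by rewrite tw_u.unlock.
apply/eqP/negPn/negP => /xg xa0.
by have := sx a (mem_head _ _); rewrite -mcoeff_neq0 xa0 eqxx.
Qed.

Lemma tw_homog0 g : tw_homog g 0. Proof. exact: lspan0. Qed.

Lemma tw_homog_lin g (a : F) x y :
  tw_homog g x -> tw_homog g y -> tw_homog g (a *: x + y).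
Proof. exact: lspan_lin. Qed.

Lemma tw_homogM g h x y :
  tw_homog g x -> tw_homog h y -> tw_homog (g * h)%g (x * y).
Proof.
move=> xg yh; elim: xg => [|k _ u [a pa ->] _ IH].
  by rewrite mul0r; apply: lspan0.
rewrite mulrDl; apply: lspanD => //; rewrite -scalerAl; apply: lspanZ => {IH}.
elim: yh => [|l _ v [b pb ->] _ IH].
  by rewrite mulr0; apply: lspan0.
rewrite mulrDr; apply: lspanD => //; rewrite -scalerAr; apply: lspanZ.
have -> : tw_u c a * tw_u c b = c a b *: tw_u c (a * b)%g by apply: tw_muluu.
apply/lspanZ/lspanS.
by exists (a * b)%g => //; rewrite gmulfM pa pb.
Qed.

Lemma mcoeff_dsum (d : {malg T[G]}) (a : Gamma) :
  (forall g, tw_homog g d@_g) -> (dsum d : T)@_a = (d@_(pi a))@_a.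
Proof.
move=> dh; rewrite /dsum raddf_sum /=.
have [pin|pout] := boolP (pi a \in msupp d).
  rewrite (big_fsetD1 _ pin) /= big1_fset ?addr0 // => g.
  rewrite !inE eq_sym => /andP[ga _] _.
  by have /tw_homogP := dh g; apply.
rewrite (mcoeff_outdom pout) mcoeff0 big1_fset // => g gin _.
have /tw_homogP := dh g; apply; apply: contraNneq pout => ->; exact: gin.
Qed.

Lemma tw_direct (x : T) : exists! d : {malg T[G]},
  (forall g, tw_homog g d@_g) /\ x = dsum d.
Proof.
pose d : {malg T[G]} := \sum_(a <- msupp x) << (<< x@_a *g a >> : T) *g pi a >>.
have dh g : tw_homog g d@_g.
  apply/tw_homogP => a pag; rewrite 2!raddf_sum /= big1_fset // => b bin _.
  rewrite mcoeffU; case: eqP => [pb|_]; last exact: mcoeff0.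
  rewrite mulr1n mcoeffU; case: eqP => // ba.
  by rewrite -ba pb eqxx in pag.
have xd : x = dsum d.
  rewrite {1}[x]monalgE /d raddf_sum; apply: eq_bigr => a _; exact/esym/dsumU.
exists d; split=> // e [eh xe].
apply/malgP => g; apply/malgP => a.
have [pa|pa] := eqVneq (pi a) g.
  by rewrite -pa -!mcoeff_dsum // -xd -xe.
have /tw_homogP dh' := dh g; have /tw_homogP eh' := eh g.
by rewrite dh' // eh'.
Qed.

Definition twisted_group_algebra : gradedAlg G F := GradedAlg
  (Grading tw_homog0 tw_homog_lin tw_homogM tw_direct).

End TwistedGrading.

Definition group_extension (N Gamma G : groupType)
    (i : UMagmaMorphism.type N Gamma) (pi : UMagmaMorphism.type Gamma G) : Prop :=
  [/\ injective i,
      (forall x, pi x = 1%g <-> exists n, i n = x) &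
      (forall g, exists x, pi x = g)].

Section PullBack.
Variables (Gamma Gamma' G : groupType).
Variables (pi : UMagmaMorphism.type Gamma G) (pi' : UMagmaMorphism.type Gamma' G).

Definition pullback_pred : {pred Gamma * Gamma'} :=
  [pred x | pi x.1 == pi' x.2].

Lemma pullback_closed : group_closed pullback_pred.
Proof.
split=> [|x y]; rewrite !inE ?gmulf1 // => /eqP xE /eqP yE.
by rewrite /= !gmulfF xE yE.
Qed.

Definition pullback : Type := {x : Gamma * Gamma' | x \in pullback_pred}.
HB.instance Definition _ := SubChoice.on pullback.
HB.instance Definition _ := 
  SubChoice_isSubGroup.Build (Gamma * Gamma')%type pullback_pred pullback
    pullback_closed.

Definition pullback_proj_fun (x : pullback) : G := pi (val x).1.

Lemma pullback_projF : {morph pullback_proj_fun : x y / (x / y)%g}.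
Proof. by move=> x y; rewrite /pullback_proj_fun /= gmulfF. Qed.
HB.instance Definition _ :=
  isGroupMorphism.Build pullback G pullback_proj_fun pullback_projF.

Definition pullback_proj : UMagmaMorphism.type pullback G :=
  UMagmaMorphism.clone pullback G pullback_proj_fun _.

Variables (F : fieldType) (c : cocycle2 Gamma F) (c' : cocycle2 Gamma' F).

Definition pullback_cocycle_fun (x y : pullback) : F :=
  c (val x).1 (val y).1 * c' (val x).2 (val y).2.

Lemma pullback_cocycle_neq0 x y : pullback_cocycle_fun x y != 0.
Proof. by rewrite mulf_neq0 ?cocycle_neq0. Qed.

Lemma pullback_cocycleP x y z :
  pullback_cocycle_fun x y * pullback_cocycle_fun (x * y)%g z = pullback_cocycle_fun y z * pullback_cocycle_fun x (y * z)%g.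
Proof. by rewrite /pullback_cocycle_fun mulrACA !cocycleP mulrACA. Qed.

Definition pullback_cocycle : cocycle2 pullback F := Cocycle2 pullback_cocycle_neq0 pullback_cocycleP.

End PullBack.

Arguments pullback_proj {Gamma Gamma' G} pi pi'.
Arguments pullback_cocycle {Gamma Gamma' G} pi pi' {F} c c'.

(* Main.v *)
Require Import Defs.
From HB Require Import structures.
From mathcomp Require Import all_boot all_algebra.
From mathcomp Require Import finmap monalg boolp.

(** Write [u], [u'] and [w] for the canonical bases of the twisted group
    algebras of [Gamma], [Gamma'] and of their pull-back [PB].  The degree-[g]
    component of the graded product is spanned by the tensors of homogeneous
    elements of degree [g], hence, expanding both factors, by the
    [tens (u a) (u' b)] with [pi a = pi' b = g] ([graded_prod_comp_span]).  Such
    pairs [(a, b)] are exactly the elements of [PB] above [g], so the linear map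
    [w (a, b) |-> tens (u a) (u' b)], called [pullback_embed], sends the
    degree-[g] component of the twisted group algebra of [PB] onto that of the
    graded product.  It is multiplicative because both products carry the
    scalar [c a1 a2 * c' b1 b2] ([pullback_embedM]).

    Injectivity would follow from the linear independence of the
    [tens (u a) (u' b)].  It is obtained here from an explicit retraction,
    [pullback_retract], defined on the whole tensor product: it sends
    [tens (u a) (u' b)] to [w (a, b)] if [(a, b)] lies in [PB], and to [0]
    otherwise.  Restricted to the graded product, this retraction is also a right
    inverse, and it is the required isomorphism: linearity is part of its
    construction, while multiplicativity and compatibility with the degrees are
    transported from [pullback_embed]. *)

Set Implicit Arguments.
Unset Strict Implicit.
Unset Printing Implicit Defensive.

Import GRing.Theory.
Local Open Scope ring_scope.

(** * Bilinear maps and tensors *)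

Section BilinearExtension.
Variables (F : fieldType) (K K' : choiceType) (U : lmodType F).
Variable h : K -> K' -> U.

Definition bilext (x : {malg F[K]}) (y : {malg F[K']}) : U :=
  lext (fun k => lext (h k) y) x.

Lemma bilextPl a x1 x2 y :
  bilext (a *: x1 + x2) y = a *: bilext x1 y + bilext x2 y.
Proof. exact: linearP. Qed.

Lemma bilextPr a x y1 y2 :
  bilext x (a *: y1 + y2) = a *: bilext x y1 + bilext x y2.
Proof.
elim/malg_ind: x => [|b k x IH]; first by rewrite /bilext !linear0 addr0.
rewrite !bilextPl {}IH /bilext !lextU linearP !scalerDr addrACA.
by rewrite !scalerA [b * a]mulrC.
Qed.

Lemma bilextU k k' : bilext << k >> << k' >> = h k k'.
Proof. by rewrite /bilext !lextU. Qed.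

End BilinearExtension.

Lemma tens0r (F : fieldType) (V W : lmodType F) (v : V) : tens v (0 : W) = 0.
Proof.
by have := tensPr (-1) v (0 : W) 0; rewrite scaler0 addr0 scaleN1r addNr.
Qed.

Lemma tensZZ (F : fieldType) (V W : lmodType F) (a b : F) (v : V) (w : W) :
  tens (a *: v) (b *: w) = (a * b) *: tens v w.
Proof.
have := tensPl a v 0 (b *: w); rewrite !addr0 tens0l addr0 => ->.
by have := tensPr b v w 0; rewrite !addr0 tens0r addr0 => ->; rewrite scalerA.
Qed.

(** * The basis of a twisted group algebra *)

Section TwistedBasis.
Variables (F : fieldType) (Gamma : groupType) (c : cocycle2 Gamma F).

Lemma tw_uM a b : tw_u c a * tw_u c b = c a b *: tw_u c (a * b)%g.
Proof. exact: tw_muluu. Qed.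

Lemma tw_1E : 1 = (c 1%g 1%g)^-1 *: tw_u c 1%g.
Proof. by rewrite -[RHS]addr0; exact: tw_oneE. Qed.

End TwistedBasis.

Section PullBackIsomorphism.
Variables (F : fieldType) (G Gamma Gamma' : groupType).
Variables (pi : UMagmaMorphism.type Gamma G).
Variables (pi' : UMagmaMorphism.type Gamma' G).
Variables (c : cocycle2 Gamma F) (c' : cocycle2 Gamma' F).

Local Notation A := (tw_alg c).
Local Notation A' := (tw_alg c').
Local Notation T := (tensor A A').
Local Notation PB := (pullback pi pi').
Local Notation cc := (pullback_cocycle pi pi' c c').
Local Notation B := (tw_alg cc).
Local Notation gA := (twisted_group_algebra pi c).
Local Notation gA' := (twisted_group_algebra pi' c').
Local Notation gB := (twisted_group_algebra (pullback_proj pi pi') cc).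
Local Notation GP := (graded_prod gA gA').
Local Notation GP_comp := (@graded_prod_comp G F gA gA').

(** * The embedding into the tensor product *)

Definition pullback_tens (p : PB) : T :=
  tens (tw_u c (val p).1) (tw_u c' (val p).2).

Definition pullback_embed (x : B) : T := lext pullback_tens x.

Lemma pullback_embedP k (x y : B) :
  pullback_embed (k *: x + y) = k *: pullback_embed x + pullback_embed y.
Proof. exact: linearP. Qed.

Lemma pullback_embed0 : pullback_embed 0 = 0.
Proof. exact: linear0. Qed.

Lemma pullback_embedZ k (x : B) : pullback_embed (k *: x) = k *: pullback_embed x.
Proof. by rewrite -[k *: x]addr0 pullback_embedP pullback_embed0 addr0. Qed.

Lemma pullback_embedU (p : PB) : pullback_embed (tw_u cc p) = pullback_tens p.
Proof. by rewrite /pullback_embed tw_u.unlock; exact: lextU. Qed.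

(** By bilinearity this is a comparison on basis elements, where it amounts to
    the definition of the pull-back cocycle as a product of values of [c] and
    [c']. *)
Lemma pullback_embedM (x y : B) :
  pullback_embed (x * y) = pullback_embed x * pullback_embed y.
Proof.
elim/tw_ind: x => [|k p x IH]; first by rewrite mul0r !pullback_embed0 mul0r.
rewrite mulrDl -scalerAl !pullback_embedP {}IH mulrDl -scalerAl.
congr (_ *: _ + _).
elim/tw_ind: y => [|l q y IH]; first by rewrite mulr0 !pullback_embed0 mulr0.
rewrite mulrDr -scalerAr !pullback_embedP {}IH mulrDr -scalerAr.
congr (_ *: _ + _).
by rewrite tw_uM pullback_embedZ !pullback_embedU tensM !tw_uM tensZZ.
Qed.

Lemma pullback_embed1 : pullback_embed 1 = 1.
Proof.
rewrite tw_1E pullback_embedZ pullback_embedU.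
transitivity (tens (1 : A) (1 : A')); last by [].
by rewrite !tw_1E tensZZ -invfM.
Qed.

Lemma pullback_embed_homog g (x : B) :
  @homog _ _ gB g x -> GP_comp g (pullback_embed x).
Proof.
elim=> [|k _ y [p pg ->] _ IH]; first by rewrite pullback_embed0; apply: lspan0.
rewrite pullback_embedP pullback_embedU; apply: lspanZD => //.
exists (tw_u c (val p).1); first by apply: lspanS; exists (val p).1.
exists (tw_u c' (val p).2) => //; apply: lspanS; exists (val p).2 => //.
by rewrite -(eqP (valP p)).
Qed.

Lemma pullback_embed_mem (x : B) :
  pullback_embed x \in @graded_prod_mem G F gA gA'.
Proof.
elim/tw_ind: x => [|k p x IH]; first by rewrite pullback_embed0; apply: rpred0.
rewrite pullback_embedP; apply: rpredD IH; apply: rpredZ.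
apply/(@graded_prod_comp_mem _ _ _ _ (pullback_proj pi pi' p)).
by apply/pullback_embed_homog/lspanS; exists p.
Qed.

(** * The retraction *)

Definition pullback_pair (a : Gamma) (b : Gamma') : B :=
  if (insub (a, b) : option PB) is Some p then tw_u cc p else 0.

Lemma bilin_pullback_pair : bilin (bilext pullback_pair : A -> A' -> B).
Proof. by split=> *; [exact: bilextPl | exact: bilextPr]. Qed.

(** Working on all of [T], and not only on the graded product, gives access to
    the universal property: a bilinear map is enough to define the retraction.
    This is why [pullback_pair] is extended by [0] off the pull-back. *)
Definition pullback_retract (t : T) : B :=
  tlift (bilext pullback_pair : A -> A' -> B) t.

Lemma pullback_retractP k (x y : T) :
  pullback_retract (k *: x + y) = k *: pullback_retract x + pullback_retract y.
Proof. exact/tliftP/bilin_pullback_pair. Qed.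

Lemma pullback_retract0 : pullback_retract 0 = 0.
Proof. exact/tlift0/bilin_pullback_pair. Qed.

Lemma pullback_retractU (p : PB) : pullback_retract (pullback_tens p) = tw_u cc p.
Proof.
rewrite /pullback_retract tlift_tens; last exact: bilin_pullback_pair.
transitivity (pullback_pair (val p).1 (val p).2).
  by rewrite !tw_u.unlock; exact: bilextU.
by rewrite /pullback_pair -surjective_pairing valK.
Qed.

Lemma pullback_embedK : cancel pullback_embed pullback_retract.
Proof.
elim/tw_ind => [|k p x IH]; first by rewrite pullback_embed0 pullback_retract0.
by rewrite pullback_embedP pullback_retractP IH pullback_embedU pullback_retractU.
Qed.

(** * The components of the graded product *)

Definition pullback_span (g : G) : T -> Prop :=
  lspan (fun t => exists2 p : PB, pullback_proj pi pi' p = g & t = pullback_tens p).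

Lemma tens_homog_span g (x : A) (y : A') :
  tw_homog pi g x -> tw_homog pi' g y -> pullback_span g (tens x y).
Proof.
move=> xg yg; elim: xg => [|k _ x1 [a pa ->] _ IH].
  by rewrite tens0l; apply: lspan0.
rewrite tensPl; apply: lspan_lin IH => {k x1}.
elim: yg => [|k _ y1 [b pb ->] _ IH].
  by rewrite tens0r; apply: lspan0.
rewrite tensPr; apply: lspan_lin IH => {k y1}; apply: lspanS.
have ab : (a, b) \in pullback_pred pi pi' by rewrite inE /= pa pb.
by exists (exist _ (a, b) ab).
Qed.

(** Pairs of basis elements of the same degree [g] are the points of the
    pull-back above [g]; this is where the grading of the product meets the
    definition of the pull-back. *)
Lemma graded_prod_comp_span g (t : T) : GP_comp g t -> pullback_span g t.
Proof.
elim=> [|k _ y [x xg [x' xg' ->]] _ IH]; first exact: lspan0.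
exact: (lspan_lin k (tens_homog_span xg xg') IH).
Qed.

Lemma pullback_retractK_comp g (t : T) :
  GP_comp g t -> pullback_embed (pullback_retract t) = t.
Proof.
move/graded_prod_comp_span; elim=> [|k _ y [p _ ->] _ IH].
  by rewrite pullback_retract0 pullback_embed0.
rewrite pullback_retractP pullback_embedP [X in _ + X]IH.
by rewrite pullback_retractU pullback_embedU.
Qed.

Lemma pullback_retract_homog g (t : T) :
  GP_comp g t -> tw_homog (pullback_proj pi pi') g (pullback_retract t).
Proof.
move/graded_prod_comp_span; elim=> [|k _ y [p pg ->] _ IH].
  by rewrite pullback_retract0; apply: lspan0.
by rewrite pullback_retractP pullback_retractU; apply: lspanZD => //; exists p.
Qed.

(** * The isomorphism *)

Definition pullback_iso (x : GP) : gB := pullback_retract (val x).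

Lemma pullback_isoK (x : GP) : pullback_embed (pullback_iso x) = val x.
Proof.
have /asboolP[d [dh xE]] := valP x; rewrite /pullback_iso xE.
apply: (big_ind (fun t : T => pullback_embed (pullback_retract t) = t)).
- by rewrite pullback_retract0 pullback_embed0.
- move=> t u IHt IHu.
  rewrite -[t in LHS]scale1r pullback_retractP pullback_embedP scale1r.
  by congr (_ + _).
- by move=> h _; exact: pullback_retractK_comp (dh h).
Qed.

Lemma pullback_iso_linear : linear pullback_iso.
Proof. by move=> k x y; rewrite /pullback_iso linearP; exact: pullback_retractP. Qed.

(** The retraction itself is in general not multiplicative on [T]: off the
    pull-back it kills a tensor of basis elements, which is a unit.  So products
    are compared after applying [pullback_embed], which is injective and
    multiplicative, and inverse to the retraction on the graded product. *)
Lemma pullback_iso_monoid : monoid_morphism pullback_iso.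
Proof.
split=> [|x y]; apply: (can_inj pullback_embedK).
  by rewrite pullback_isoK pullback_embed1.
rewrite pullback_isoK; apply/esym/(etrans (pullback_embedM _ _)).
exact: congr2 (pullback_isoK x) (pullback_isoK y).
Qed.

HB.instance Definition _ :=
  GRing.isLinear.Build F GP gB *:%R pullback_iso pullback_iso_linear.
HB.instance Definition _ :=
  GRing.isMonoidMorphism.Build GP gB pullback_iso pullback_iso_monoid.

Lemma pullback_iso_bij : bijective pullback_iso.
Proof.
exists (fun y : B => exist _ (pullback_embed y) (pullback_embed_mem y) : GP).
  by move=> x; apply: val_inj; exact: pullback_isoK.
by move=> y; exact: pullback_embedK.
Qed.

Lemma pullback_iso_homog g (x : GP) : homog g x <-> homog g (pullback_iso x).
Proof.
split=> [|/pullback_embed_homog]; last by rewrite pullback_isoK.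
exact: pullback_retract_homog.
Qed.

End PullBackIsomorphism.

Theorem theorem4p12 (F : fieldType) (G N Gamma N' Gamma' : groupType)
    (i : UMagmaMorphism.type N Gamma) (pi : UMagmaMorphism.type Gamma G)
    (i' : UMagmaMorphism.type N' Gamma') (pi' : UMagmaMorphism.type Gamma' G)
    (ext : group_extension i pi) (ext' : group_extension i' pi')
    (c : cocycle2 Gamma F) (c' : cocycle2 Gamma' F) :
  graded_iso
    (graded_prod (twisted_group_algebra pi c) (twisted_group_algebra pi' c'))
    (twisted_group_algebra (pullback_proj pi pi') (pullback_cocycle pi pi' c c')).
Proof.
exists (@pullback_iso F G Gamma Gamma' pi pi' c c').
by split; [exact: pullback_iso_bij | exact: pullback_iso_homog].
Qed.
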